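(* Assume that $X[\mathcal{T}]$ is a locally convex topological vector space, $\mathcal{C}$ is a non-decreasing countable localizing family in $X$, and each member of $\mathcal{C}$ is absolutely convex and $\mathcal{T}$-compact. Then the following is a local base of the localized topology $\mathcal{T}_{\mathcal{C}}$: $$\mathcal{B}=\Big\{\bigcap_{n\in\mathbb{N}}{}^\circ\{x_n^*\}:\langle x_n^*\rangle_n\text{ is a }\beta(X^*,X)\text{-null sequence in }X[\mathcal{T}_{\mathcal{C}}]^*\Big\},$$ where ${}^\circ\{x^*\}=\{x\in X:|\langle x,x^*\rangle|\le1\}$.
   Context: All vector spaces are real; topological vector spaces are Hausdorff. $X[\mathcal{T}]$ denotes $X$ equipped with the topology $\mathcal{T}$; $\mathcal{T}|_C=\{E\cap C:E\in\mathcal{T}\}$. Absolutely convex means convex and balanced. A local base of a vector topology is a set $\mathcal{B}$ of neighbourhoods of $0$ (not necessarily open) such that every neighbourhood of $0$ contains a member of $\mathcal{B}$. A null sequence is one converging to $0$. A localizing family in a vector space $X$ is a non-empty collection $\mathcal{C}$ of convex subsets of $X$ containing $0$ such that for all $C\in\mathcal{C}$, $x\in X$, $t\in\mathbb{R}$ there is $D\in\mathcal{C}$ with $x+t\cdot C\subseteq D$. It is non-decreasing countable if it can be numbered $\mathcal{C}=\{C_k:k\in\mathbb{N}\}$ with $C_k\subseteq C_{k+1}$ for all $k$. The localization $\mathcal{T}_{\mathcal{C}}$ is the locally convex vector topology on $X$ consisting of all $E\subseteq X$ such that for every $x\in E$ there is a convex $V$ with $x\in V\subseteq E$ and $V\cap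 C\in\mathcal{T}|_C$ for every $C\in\mathcal{C}$. $X[\mathcal{T}_{\mathcal{C}}]^*$ is the space of $\mathcal{T}_{\mathcal{C}}$-continuous linear forms on $X$; $\beta(X^*,X)$ is its strong topology (uniform convergence on $\mathcal{T}_{\mathcal{C}}$-bounded subsets of $X$). *)

(* Defs.v *)
From HB Require Import structures.
From mathcomp Require Import all_boot all_order all_algebra.
From mathcomp Require Import all_classical all_reals all_analysis.

Set Implicit Arguments.
Unset Strict Implicit.
Unset Printing Implicit Defensive.

Import Order.TTheory GRing.Theory Num.Theory.
Import numFieldNormedType.Exports.

Local Open Scope classical_set_scope.
Local Open Scope ring_scope.

Definition balanced_set (R : realType) (X : lmodType R) (A : set X) : Prop :=
  forall (t : R) (x : X), `|t| <= 1 -> A x -> A (t *: x).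

Definition absolutely_convex (R : realType) (X : lmodType R) (A : set X) :
    Prop :=
  convex_set A /\ balanced_set A.

Definition localizing_family (R : realType) (X : lmodType R)
    (C : set (set X)) : Prop :=
  [/\ C !=set0,
      forall A, C A -> convex_set A /\ A 0
    & forall (A : set X) (x : X) (t : R), C A ->
        exists2 D, C D & [set x + t *: a | a in A] `<=` D].

Definition nondecreasing_countable (X : Type) (C : set (set X)) : Prop :=
  exists2 c : nat -> set X, C = range c & forall k, c k `<=` c k.+1.

Definition relative_topology (X : topologicalType) (A : set X) : set (set X) :=
  [set U `&` A | U in open].

(* The vector space X retopologized by the localization of its topology at C;
   the open sets form a topology for an arbitrary collection C. *)
Definition localized (R : realType) (X : preTopologicalLmodType R)
  (C : set (set X)) : Type := X.

Section localized_topology.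
Context (R : realType) (X : preTopologicalLmodType R) (C : set (set X)).

Definition localized_open : set (set X) :=
  [set U | forall x, U x -> exists V : set X,
     [/\ convex_set V, V x, V `<=` U
       & forall A, C A -> relative_topology A (V `&` A)]].

Lemma localized_openT : localized_open setT.
Proof.
move=> x _; exists setT; split=> //.
by move=> A _; exists setT; [exact: openT|].
Qed.

Lemma localized_openI : setI_closed localized_open.
Proof.
move=> U1 U2 oU1 oU2 x [/oU1[V1 [cV1 V1x VU1 CV1]] /oU2[V2 [cV2 V2x VU2 CV2]]].
exists (V1 `&` V2); split.
- move=> y z l; rewrite !in_setI => /andP[y1 y2] /andP[z1 z2].
  by rewrite cV1 ?cV2.
- by [].
- exact: setISS.
- move=> A CA; have [W1 oW1 W1E] := CV1 A CA; have [W2 oW2 W2E] := CV2 A CA.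
  exists (W1 `&` W2); first exact: openI.
  by rewrite setIIl W1E W2E -setIIl.
Qed.

Lemma localized_open_bigU (I : Type) (f : I -> set X) :
  (forall i, localized_open (f i)) -> localized_open (\bigcup_i f i).
Proof.
move=> of_ x [i _ /(of_ i)[V [cV Vx Vf CV]]]; exists V; split=> //.
by move=> y /Vf fy; exists i.
Qed.

HB.instance Definition _ := GRing.Lmodule.on (localized C).
HB.instance Definition _ := isOpenTopological.Build (localized C)
  localized_openT localized_openI localized_open_bigU.

End localized_topology.

Definition local_base (R : realType) (E : preTopologicalLmodType R)
    (B : set (set E)) : Prop :=
  B `<=` nbhs (0 : E) /\
  forall U, nbhs (0 : E) U -> exists2 V, B V & V `<=` U.

(* Boundedness in the sense of topological vector spaces: absorbed by every
   neighbourhood of 0. *)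
Definition vbounded (R : realType) (E : preTopologicalLmodType R) :
    set (set E) :=
  [set S | forall U, nbhs (0 : E) U ->
     exists2 r : R, 0 < r &
       forall t : R, r <= `|t| -> S `<=` [set t *: u | u in U]].

(* The continuous dual; as a type it carries the subtype topology of
   {family @vbounded R E, E -> R^o}, i.e. the strong topology. *)
Definition dual (R : realType) (E : preTopologicalLmodType R) :
    set {family @vbounded R E, E -> R^o} :=
  [set f | linear (f : E -> R^o) /\ continuous (f : E -> R^o)].
Arguments dual {R} E.

Lemma dual0 (R : realType) (E : preTopologicalLmodType R) :
  (cst 0 : E -> R^o) \in dual E.
Proof.
apply/mem_set; split => [t x y|]; last by move=> x; exact: cvg_cst.
by rewrite /cst scaler0 addr0.
Qed.

Definition zero_form (R : realType) (E : preTopologicalLmodType R) : dual E :=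
  exist _ (cst 0 : E -> R^o) (dual0 E).
Arguments zero_form {R} E.

Definition prepolar (R : realType) (E : preTopologicalLmodType R)
    (f : dual E) : set E :=
  [set x | `|(set_val f : E -> R^o) x| <= 1].

(* Main.v *)
(* A sequence of localized-continuous forms that tends to 0 uniformly on each
   member of the family has a prepolar whose trace on a member is cut out by
   finitely many of them, so this prepolar is a localized neighbourhood of 0.
   Members of the family are bounded since they are compact; conversely, a
   bounded set lies in a multiple r C_k, since otherwise separating its points
   from multiples of the C_k yields a sequence as above that is unbounded on it.
   Hence the strong null sequences are those tending to 0 uniformly on each C_k.
   The reverse inclusion is the Banach-Dieudonne argument: given V convex, open
   in the trace on each member, one builds finite sets F_k in the polar of
   D_k = k C_(k-1) such that the prepolar of F_0, ..., F_k meets D_(k+1)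
   inside V; F_k exists by compactness of D_(k+1) minus V and the bipolar
   theorem. *)
Require Import Defs.
From HB Require Import structures.
From mathcomp Require Import all_boot all_order all_algebra.
From mathcomp Require Import all_classical all_reals all_analysis.
From mathcomp Require Import ring lra.

Set Implicit Arguments.
Unset Strict Implicit.
Unset Printing Implicit Defensive.

Import Order.TTheory GRing.Theory Num.Theory.
Import numFieldNormedType.Exports.

Local Open Scope classical_set_scope.
Local Open Scope ring_scope.

(** * The strong topology of the dual *)

(** The dual carries the initial topology of its inclusion into the function space, so convergence
    can be tested after inclusion. *)
Lemma cvg_zero_formP (R : realType) (E : preTopologicalLmodType R)
    (x : nat -> dual E) :
  x @ \oo --> zero_form E <->
  forall S, vbounded S -> forall e : R, 0 < e ->
    \forall n \near \oo, forall y, S y -> `|(set_val (x n) : E -> R^o) y| < e.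
Proof.
have cvgE : (x @ \oo --> zero_form E) <->
    {family (@vbounded R E),
      (set_val \o x @ \oo) --> (set_val (zero_form E) : E -> R^o)}.
  split=> [xz|xz U].
    by apply: (cvg_trans (cvg_app _ xz)); exact: initial_continuous.
  rewrite nbhsE => -[V [[B oB BV] Vz] VU].
  have : nbhs (set_val (zero_form E) : {family (@vbounded R E), E -> R^o}) B.
    by apply: open_nbhs_nbhs; split=> //; rewrite -BV in Vz.
  move=> /xz Bx.
  suff : \forall n \near \oo, U (x n) by [].
  have : \forall n \near \oo, B (set_val (x n)) by exact: Bx.
  by apply: filterS => n Bn; apply: VU; rewrite -BV.
rewrite cvgE fam_cvgP; split=> [H S bS e e0|H S bS P /uniform_nbhs[Q [entQ QP]]].
  suff /(H S bS) : @nbhs _ {uniform` S -> R^o} (set_val (zero_form E))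
    [set h | forall y, S y -> `|h y| < e] by [].
  apply/uniform_nbhs; exists [set p | `|p.1 - p.2| < e].
  split; first by rewrite -entourage_ballE; exists e => //=.
  by move=> h /= Hh y /Hh; rewrite sub0r normrN.
move: entQ; rewrite -entourage_ballE => -[e /= e0 eQ].
suff : \forall n \near \oo, P (set_val (x n)) by [].
apply: filterS (H S bS e e0) => n Hn; apply: QP => y /Hn yn.
by apply: eQ; rewrite /= /ball /= sub0r normrN.
Qed.

(** * The Hahn-Banach theorem *)

(** Positive homogeneity in disguise: the inequality at [t^-1] is the reverse one at [t]. *)
Definition sublinear (R : realType) (X : lmodType R) (p : X -> R) : Prop :=
  (forall x y, p (x + y) <= p x + p y) /\
  (forall (t : R) x, 0 < t -> p (t *: x) <= t * p x).

Section sublinear_functionals.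
Context (R : realType) (X : lmodType R).
Implicit Types p q : X -> R.

Lemma sublinear0 p : sublinear p -> p 0 = 0.
Proof.
move=> [_ pZ]; have h2 : (0 : R) < 2 by [].
have h12 : (0 : R) < 2^-1 by rewrite invr_gt0.
have := pZ _ 0 h2; have := pZ _ 0 h12; rewrite !scaler0.
lra.
Qed.

Lemma sublinear_geN p x : sublinear p -> - p (- x) <= p x.
Proof.
move=> sp; have := sp.1 x (- x); rewrite subrr sublinear0// => ?; lra.
Qed.

Lemma sublinear_geZ p (t : R) x :
  sublinear p -> 0 <= t -> t * p x <= p (t *: x).
Proof.
move=> sp; rewrite le_eqVlt => /predU1P[<-|t0].
  by rewrite mul0r scale0r sublinear0.
have ti0 : 0 < t^-1 by rewrite invr_gt0.
have := sp.2 _ (t *: x) ti0; rewrite scalerA mulVf ?gt_eqF// scale1r.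
by rewrite mulrC ler_pdivlMr// mulrC.
Qed.

(** Serves three infima: the one in [sublinear_drop], the lower bound of a chain, and the gauge. *)
Lemma sublinear_inf (S : X -> set R) :
  (forall x, has_inf (S x)) ->
  (forall x y a b, S x a -> S y b -> exists2 c, S (x + y) c & c <= a + b) ->
  (forall (t : R) x a, 0 < t -> S x a ->
    exists2 c, S (t *: x) c & c <= t * a) ->
  sublinear (fun x => inf (S x)).
Proof.
move=> Sinf SD SZ; split=> [x y|t x t0].
  rewrite -lerBlDr; apply: lb_le_inf => [|a Sa]; first by case: (Sinf x).
  rewrite lerBlDl -lerBlDr; apply: lb_le_inf => [|b Sb].
    by case: (Sinf y).
  rewrite lerBlDl; have [c Sc cab] := SD _ _ _ _ Sa Sb.
  by apply: le_trans cab; apply: ge_inf => //; case: (Sinf (x + y)).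
rewrite mulrC -ler_pdivrMr//; apply: lb_le_inf => [|a Sa].
  by case: (Sinf x).
rewrite ler_pdivrMr// mulrC; have [c Sc ca] := SZ _ _ _ t0 Sa.
by apply: le_trans ca; apply: ge_inf => //; case: (Sinf (t *: x)).
Qed.

(* Applied to a minimal [q], this makes [q] odd, hence linear. *)
Lemma sublinear_drop q y : sublinear q ->
  exists q', [/\ sublinear q', forall x, q' x <= q x & q' (- y) <= - q y].
Proof.
(* [t = 0] gives [q' <= q] and [t = 1] the bound at [- y]; the infimum is finite as
   [q (x + t *: y) >= t * q y - q (- x)]. *)
move=> sq; pose S x := [set q (x + t *: y) - t * q y | t in [set t | 0 <= t]].
have Sinf x : has_inf (S x).
  split; first by exists (q (x + 0 *: y) - 0 * q y), 0 => /=.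
  exists (- q (- x)) => _ [t /= t0 <-].
  have := sq.1 (x + t *: y) (- x); rewrite addrAC subrr add0r.
  have := sublinear_geZ y sq t0; lra.
exists (fun x => inf (S x)); split.
- apply: sublinear_inf => // [x z a b [t /= t0 <-] [s /= s0 <-]|].
    exists (q (x + z + (t + s) *: y) - (t + s) * q y).
      by exists (t + s) => //=; rewrite addr_ge0.
    by have := sq.1 (x + t *: y) (z + s *: y); rewrite addrACA -scalerDl; lra.
  move=> s x a s0 [t /= t0 <-].
  exists (q (s *: x + (s * t) *: y) - (s * t) * q y).
    by exists (s * t) => //=; rewrite mulr_ge0// ltW.
  by have := sq.2 s (x + t *: y) s0; rewrite scalerDr scalerA; lra.
- move=> x; apply: ge_inf; first by case: (Sinf x).
  by exists 0 => //=; rewrite scale0r addr0 mul0r subr0.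
- apply: ge_inf; first by case: (Sinf (- y)).
  by exists 1 => //=; rewrite scale1r addNr sublinear0// mul1r sub0r.
Qed.

(** Zorn's lemma: the infimum of a chain is sublinear because any two members are comparable, and
    finite because each member is at least [- p (- x)] at [x]. *)
Lemma minimal_sublinear p : sublinear p -> exists q,
  [/\ sublinear q, forall x, q x <= p x
    & forall q', sublinear q' -> (forall x, q' x <= q x) -> q' = q].
Proof.
move=> sp; pose T := {q : X -> R | sublinear q /\ forall x, q x <= p x}.
(* The order is reversed, so that a maximal element is a minimal functional. *)
pose r (u v : T) := `[< forall x, sval v x <= sval u x >].
have T0 : T by exists p; split.
have rtot (A : set T) : total_on A r -> exists t, forall s, A s -> r s t.
  move=> Atot; have [[u0 Au0]|A0] := pselect (A !=set0); last first.
    by exists T0 => s As; exfalso; apply: A0; exists s.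
  pose S x := [set sval u x | u in A].
  have Sinf x : has_inf (S x).
    split; first by exists (sval u0 x), u0.
    exists (- p (- x)) => _ [[u [su up]] _ <-] /=.
    have := sublinear_geN x su; have := up (- x); lra.
  have Sge u x : A u -> inf (S x) <= sval u x.
    by move=> Au; apply: ge_inf; [case: (Sinf x)|exists u].
  have sS : sublinear (fun x => inf (S x)).
    apply: sublinear_inf => // [x y _ _ [u Au <-] [v Av <-]|t x _ t0 [u Au <-]].
      have [/asboolP uv|/asboolP vu] := Atot _ _ Au Av.
        exists (sval v (x + y)); first by exists v.
        by have := uv x; have := (svalP v).1.1 x y; lra.
      exists (sval u (x + y)); first by exists u.
      by have := vu y; have := (svalP u).1.1 x y; lra.
    exists (sval u (t *: x)); first by exists u.
    exact: (svalP u).1.2.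
  have Sp x : inf (S x) <= p x.
    by apply: le_trans (Sge _ x Au0) _; case: (svalP u0).
  exists (exist _ (fun x => inf (S x)) (conj sS Sp)) => u Au.
  by apply/asboolP => x; exact: Sge.
have [||[q [sq qp]] qmin] := @ZL_preorder T T0 r _ _ rtot.
- by move=> t; apply/asboolP.
- move=> a b c /asboolP ab /asboolP bc; apply/asboolP => x.
  exact: le_trans (bc x) (ab x).
exists q; split=> // q' sq' q'q; apply/funext => x; apply/le_anti.
have q'p x' : q' x' <= p x' by exact: le_trans (q'q x') (qp x').
have : r (exist _ q (conj sq qp)) (exist _ q' (conj sq' q'p)) by apply/asboolP.
by move=> /qmin /asboolP/(_ x) /= qq'; rewrite q'q.
Qed.

(** Dropping [p] along [y] before minimizing forces [f (- y) <= - p y], which for odd [f] is the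
    missing bound [p y <= f y]. *)
Lemma hahn_banach p y : sublinear p -> exists f : X -> R^o,
  [/\ linear f, forall x, f x <= p x & f y = p y].
Proof.
move=> sp; have [p' [sp' p'p p'y]] := sublinear_drop y sp.
have [f [sf fp' fmin]] := minimal_sublinear sp'.
(* By minimality [f] equals its own drop along [x], so [f (- x) <= - f x]. *)
have fN x : f (- x) = - f x.
  have [g [sg gf gx]] := sublinear_drop x sf.
  have gE := fmin _ sg gf; rewrite gE in gx.
  by apply/le_anti; rewrite gx /= lerNl sublinear_geN.
have fD x z : f (x + z) = f x + f z.
  apply/le_anti; rewrite sf.1 /=.
  have := sf.1 (- x) (- z); rewrite -opprD !fN; lra.
have fZ (t : R) x : f (t *: x) = t * f x.
  have fZ0 (s : R) z : 0 <= s -> f (s *: z) = s * f z.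
    move=> s0; apply/le_anti; rewrite sublinear_geZ// andbT.
    by have := sublinear_geZ (- z) sf s0; rewrite scalerN !fN; lra.
  have [t0|/ltW t0] := leP 0 t; first exact: fZ0.
  by rewrite -[in LHS](opprK x) scalerN -scaleNr fZ0 ?oppr_ge0// fN mulrNN.
exists f; split.
- by move=> t x z; rewrite fD fZ.
- by move=> x; exact: le_trans (fp' x) (p'p x).
- apply/le_anti/andP; split; first exact: le_trans (fp' y) (p'p y).
  by rewrite -[leRHS]opprK -fN lerNr; exact: le_trans (fp' _) p'y.
Qed.
End sublinear_functionals.

(** * Linear forms, convex sets and gauges *)

Section linear_forms.
Context (R : realType) (X : lmodType R).
Implicit Type f : X -> R^o.

Lemma linear_form0 f : linear f -> f 0 = 0.
Proof.
by move=> /(_ (-1) 0 0); rewrite scaleN1r addNr scaleN1r addNr.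
Qed.

Lemma linear_formZ f (t : R) x : linear f -> f (t *: x) = t * f x.
Proof. by move=> lf; have := lf t x 0; rewrite linear_form0// !addr0. Qed.

Lemma linear_formN f x : linear f -> f (- x) = - f x.
Proof. by move=> lf; rewrite -scaleN1r linear_formZ// mulN1r. Qed.

End linear_forms.

Section convexity.
Context (R : realType).

Lemma convex_setP (X : lmodType R) (A : set X) : convex_set A <->
  forall x y (t : R), 0 <= t -> t <= 1 -> A x -> A y ->
    A (t *: x + (1 - t) *: y).
Proof.
split=> [cA x y t t0 t1 Ax Ay|cA x y t /set_mem Ax /set_mem Ay].
  exact: set_mem (cA x y (Itv01 t0 t1) (mem_set Ax) (mem_set Ay)).
exact/mem_set/cA.
Qed.

Definition gauge (X : lmodType R) (G : set X) (x : X) : R :=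
  inf [set t | 0 < t /\ G (t^-1 *: x)].

Section gauge_theory.
Context (X : lmodType R) (G : set X).
Context (cG : convex_set G) (G0 : G 0).
Context (absG : forall x, exists2 t : R, 0 < t & G (t^-1 *: x)).

Let gauge_has_inf x : has_inf [set t | 0 < t /\ G (t^-1 *: x)].
Proof.
split; first by have [t t0 Gt] := absG x; exists t.
by exists 0 => t [/ltW].
Qed.

Lemma gauge_sublinear : sublinear (gauge G).
Proof.
apply: sublinear_inf => // [x y a b [a0 Ga] [b0 Gb]|t x a t0 [a0 Ga]].
  have ab0 : 0 < a + b by rewrite addr_gt0.
  exists (a + b) => //; split => //.
  have -> : (a + b)^-1 *: (x + y) =
      (a / (a + b)) *: (a^-1 *: x) + (1 - a / (a + b)) *: (b^-1 *: y).
    rewrite scalerDr !scalerA; congr (_ *: _ + _ *: _); field.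
      by rewrite !gt_eqF.
    by rewrite !gt_eqF.
  apply: (convex_setP G).1 => //; first by rewrite divr_ge0// ltW.
  by rewrite ler_pdivrMr// mul1r lerDl ltW.
exists (t * a) => //; split; first by rewrite mulr_gt0.
by rewrite invfM scalerA mulrAC mulVf ?gt_eqF// mul1r.
Qed.

Lemma gauge_le1 x : G x -> gauge G x <= 1.
Proof.
move=> Gx; apply: ge_inf; first by case: (gauge_has_inf x).
by split=> //; rewrite invr1 scale1r.
Qed.

Lemma gauge_ge1 x : ~ G x -> 1 <= gauge G x.
Proof.
move=> nGx; apply: lb_le_inf => [|t [t0 Gt]]; first by case: (gauge_has_inf x).
rewrite leNgt; apply/negP => t1; apply: nGx.
(* [x] is a convex combination of [t^-1 *: x] and [0]. *)
have := (convex_setP G).1 cG _ _ _ (ltW t0) (ltW t1) Gt G0.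
by rewrite scalerA mulfV ?gt_eqF// scale1r scaler0 addr0.
Qed.

End gauge_theory.
End convexity.

(** * Separation in locally convex spaces *)

Section tvs_separation.
Context (R : realType) (X : tvsType R).

(** Joint in vector and scalar, as the near-covering form of compactness in
    [compact_vbounded_localized] demands. *)
Lemma nbhs0_scale (x : X) (U : set X) : nbhs 0 U ->
  \forall y \near x & s \near (0 : R^o), U (s *: y).
Proof.
move=> U0; have := @scale_continuous R X (0, x) U.
rewrite /= scale0r => /(_ U0)[[A B] /= [A0 Bx] AB].
by exists (B, A) => // -[y s] /= [By As]; exact: (AB (s, y)).
Qed.

Lemma nbhs0_absorbing (x : X) (U : set X) : nbhs 0 U ->
  exists2 t : R, 0 < t & U (t^-1 *: x).
Proof.
move=> /(nbhs0_scale x)[[A B] /= [Ax]].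
rewrite -nbhs_ballE => -[e /= e0 eB] AB.
exists (2 / e); first by rewrite divr_gt0.
apply: (AB (x, (2 / e)^-1)); split; first exact: nbhs_singleton.
apply: eB; rewrite /ball /= sub0r normrN invf_div gtr0_norm ?divr_gt0//.
by rewrite ltr_pdivrMr// ltr_pMr// ltr1n.
Qed.

Lemma nbhs_convex (x : X) (U : set X) : nbhs x U ->
  exists W, [/\ open W, convex_set W, W x & W `<=` U].
Proof.
have [B cB [oB bB]] := @locally_convex R X.
move=> /bB[W [BW Wx] WU]; exists W; split=> //; first exact: oB.
exact/cB/mem_set.
Qed.

(** On [x + (e / 2) U] the form differs from [f x] by at most [e / 2]. *)
Lemma linear_continuous0 (f : X -> R^o) (U : set X) : linear f -> nbhs 0 U ->
  (forall x, U x -> `|f x| <= 1) -> continuous f.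
Proof.
move=> lf U0 fU x; apply/cvgrPdist_lt => e e0.
have e20 : e / 2 != 0 by rewrite gt_eqF// divr_gt0.
have := nbhsT x (nbhs0Z e20 U0).
apply: filterS => _ [_ [u Uu <-] <-].
have -> : f (x + e / 2 *: u) = f x + e / 2 * f u.
  by rewrite addrC lf addrC.
rewrite opprD addrA subrr sub0r normrN normrM gtr0_norm ?divr_gt0//.
rewrite (@le_lt_trans _ _ (e / 2))//; last first.
  by rewrite ltr_pdivrMr// ltr_pMr// ltr1n.
have e2 : 0 <= e / 2 by lra.
by rewrite ler_piMr ?fU.
Qed.

Lemma closed_separation (D : set X) (z : X) :
  closed D -> absolutely_convex D -> D 0 -> ~ D z ->
  exists f : X -> R^o, [/\ linear f, continuous f,
    forall x, D x -> `|f x| <= 1 & 1 < f z].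
Proof.
move=> clD [cD bD] D0 nDz.
(* The slack [s < 1] turns the bound [1 <= f (s *: z)] into the strict [1 < f z]. *)
have [s [s0 s1 nDsz]] : exists s : R, [/\ 0 < s, s < 1 & ~ D (s *: z)].
  have := @scale_continuous R X (1, z) (~` D); rewrite /= scale1r.
  have nD : nbhs z (~` D).
    by apply: open_nbhs_nbhs; split; first exact: closed_openC.
  move=> /(_ nD)[[A B] /= [A1 Bz] AB].
  move: A1; rewrite -nbhs_ballE => -[e /= e0 eA].
  pose m := Num.min e 1; have m0 : 0 < m by rewrite lt_min e0 ltr01.
  have m1 : m <= 1 by rewrite ge_min lexx orbT.
  have me : m <= e by rewrite ge_min lexx.
  exists (1 - m / 2); split; [lra|lra|].
  apply: (AB (1 - m / 2, z)); split; last exact: nbhs_singleton.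
  apply: eA; rewrite /ball /= opprB addrC subrK gtr0_norm; lra.
have [W [oW cW W0 WD]] : exists W : set X, [/\ open W, convex_set W, W 0 &
    forall w, W w -> ~ D (s *: z - w)].
  have := @sub_continuous X (s *: z, 0) (~` D); rewrite /= subr0.
  have nD : nbhs (s *: z) (~` D).
    by apply: open_nbhs_nbhs; split; first exact: closed_openC.
  move=> /(_ nD)[[A B] /= [Az B0] AB].
  have [W [oW cW W0 WB]] := nbhs_convex B0.
  exists W; split=> // w Ww; apply: (AB (s *: z, w)).
  by split; [exact: nbhs_singleton|exact: WB].
(* Thickening [D] by [W] keeps [s *: z] outside and makes the set absorbing; the form is continuous
   because it is bounded on [W]. *)
pose G := [set d + w | d in D & w in W].
have cG : convex_set G.
  apply/convex_setP => _ _ t t0 t1 [d Dd [w Ww <-]] [d' Dd' [w' Ww' <-]].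
  exists (t *: d + (1 - t) *: d'); first exact: (convex_setP D).1.
  exists (t *: w + (1 - t) *: w'); first exact: (convex_setP W).1.
  by rewrite !scalerDr addrACA.
have DG : D `<=` G by move=> d Dd; exists d => //; exists 0; rewrite ?addr0.
have WG : W `<=` G by move=> w Ww; exists 0 => //; exists w; rewrite ?add0r.
have nbW : nbhs 0 W by apply: open_nbhs_nbhs.
have absG (x : X) : exists2 t : R, 0 < t & G (t^-1 *: x).
  by have [t t0 /WG Gt] := nbhs0_absorbing x nbW; exists t.
have [f [lf fle fz]] := hahn_banach (s *: z) (gauge_sublinear cG absG).
have fG x : G x -> f x <= 1.
  by move=> Gx; exact: le_trans (fle x) (gauge_le1 absG Gx).
exists f; split=> //.
- apply: (@linear_continuous0 f (W `&` -%R @` W)) => //.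
    by apply: filterI => //; exact: nbhs0N.
  move=> y [Wy [x /WG/fG fx xE]]; rewrite ler_norml; apply/andP; split.
    by rewrite -xE linear_formN// lerN2.
  exact/fG/WG.
- move=> x Dx; rewrite ler_norml; apply/andP; split; last exact/fG/DG.
  rewrite -[x]opprK linear_formN// lerN2; apply/fG/DG.
  by rewrite -scaleN1r; apply: bD => //; rewrite normrN1.
- have : 1 <= f (s *: z).
    rewrite fz; apply: (gauge_ge1 cG (DG _ D0) absG) => -[d Dd [w Ww dw]].
    by apply: (WD w Ww); rewrite -dw addrK.
  rewrite linear_formZ//; nra.
Qed.
End tvs_separation.

(** * The localized topology *)

Section localization.
Context (R : realType) (X : tvsType R).
Implicit Types (C : set (set X)) (f : X -> R^o).

Lemma convex_preimage f (A : set R^o) : linear f -> convex_set A ->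
  convex_set (f @^-1` A).
Proof.
move=> lf cA; apply/convex_setP => x y t t0 t1 /= fx fy.
by rewrite lf linear_formZ//; apply: (convex_setP A).1.
Qed.

Lemma localized_openE C : @open (localized C) = localized_open C.
Proof. by []. Qed.

(** The definition gives open traces only for the convex pieces around points; the union of all open
    sets with trace inside [U] collects them. *)
Lemma localized_open_trace C (U A : set X) : localized_open C U -> C A ->
  exists2 W : set X, open W & W `&` A = U `&` A.
Proof.
move=> oU CA; exists (\bigcup_(W in [set W | open W /\ W `&` A `<=` U]) W).
  by apply: bigcup_open => W [].
rewrite predeqE => x; split=> [[[W [oW WU] Wx] Ax]|[Ux Ax]].
  by split=> //; exact: WU.
have [V [_ Vx VU /(_ A CA)[W oW WV]]] := oU x Ux.
have [Wx _] : (W `&` A) x by rewrite WV.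
split=> //; exists W => //; split=> //.
by rewrite WV => y [/VU].
Qed.

(** Such a [V] is itself localized-open, being the convex witness at each of its points. *)
Lemma nbhs_localizedP C (U : set X) : nbhs (0 : localized C) U <->
  exists V : set X, [/\ convex_set V, V 0, V `<=` U
    & forall A, C A -> exists2 W : set X, open W & W `&` A = V `&` A].
Proof.
split=> [|[V [cV V0 VU CV]]].
  rewrite nbhsE => -[V' [oV' V'0] V'U].
  have [V [cV V0 VV' CV]] := oV' 0 V'0.
  by exists V; split=> //; exact: subset_trans V'U.
have oV : @open (localized C) V.
  by rewrite localized_openE; move=> x Vx; exists V; split=> //; exact: CV.
by apply: (filterS VU); apply: open_nbhs_nbhs.
Qed.

Lemma continuous_localized C f : linear f -> continuous f ->
  continuous (f : localized C -> R^o).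
Proof.
move=> lf /continuousP cf; apply/continuousP => B oB.
rewrite localized_openE => x /= Bx.
have [W [oW cW Wx WB]] : exists W : set R^o,
    [/\ open W, convex_set W, W (f x) & W `<=` B].
  by apply: nbhs_convex; exact: open_nbhs_nbhs.
exists (f @^-1` W); split=> //.
- exact: convex_preimage.
- by move=> y /WB.
- by move=> A _; exists (f @^-1` W) => //; exact: cf.
Qed.

Lemma nbhs_localized_polar C (x : nat -> X -> R^o) :
  (forall n, linear (x n)) ->
  (forall n, continuous (x n : localized C -> R^o)) ->
  (forall A, C A -> \forall n \near \oo, forall y, A y -> `|x n y| < 1) ->
  nbhs (0 : localized C) [set y | forall n, `|x n y| <= 1].
Proof.
move=> lx cx Cx; apply/nbhs_localizedP.
have cB n : convex_set (x n @^-1` ball (0 : R^o) 1).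
  apply: convex_preimage => //; apply/convex_setP => a b t t0 t1.
  rewrite /ball /= !sub0r !normrN => a1 b1.
  rewrite (le_lt_trans (ler_normD _ _))// !normrM (ger0_norm t0).
  rewrite (@ger0_norm _ (1 - t)) ?subr_ge0//.
  move: t0; rewrite le_eqVlt => /predU1P[<-|t0].
    by rewrite mul0r add0r subr0 mul1r.
  nra.
have BE n y : (x n @^-1` ball (0 : R^o) 1) y = is_true (`|x n y| < 1).
  by rewrite /ball /= sub0r normrN.
(* Strict inequalities make each condition relatively open; on [A] those from some [N] on hold
   automatically. *)
exists [set y | forall n, `|x n y| < 1]; split.
- apply/convex_setP => y z t t0 t1 /= y1 z1 n; rewrite -BE.
  by apply: (convex_setP _).1 => //; rewrite BE.
- by move=> n /=; rewrite linear_form0// normr0.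
- by move=> y xy n; exact/ltW.
- move=> A CA; have [N _ NA] := Cx A CA.
  have [W oW WN] : exists2 W : set X, open W &
      W `&` A = [set y | forall n, (n < N)%N -> `|x n y| < 1] `&` A.
    elim: N {NA} => [|N [W oW WN]].
      by exists setT; [exact: openT|rewrite predeqE => y; split=> -[]].
    have [W' oW' W'N] : exists2 W' : set X, open W' &
        W' `&` A = (x N @^-1` ball (0 : R^o) 1) `&` A.
      apply: localized_open_trace CA => //.
      by have /continuousP := cx N; apply; exact: ball_open.
    exists (W `&` W'); first exact: openI.
    rewrite setIIl WN W'N predeqE => y; split.
      move=> [[yN Ay] []]; rewrite BE => yN' _; split=> // n.
      by rewrite ltnS leq_eqVlt => /predU1P[->|/yN].
    move=> [yN Ay]; split; split=> //; last by rewrite BE; exact: yN.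
    by move=> n nN; apply: yN; exact: ltnW.
  exists W => //; rewrite WN predeqE => y; split=> -[yN Ay]; split=> //.
  by move=> n; have [/yN//|/NA] := ltnP n N; apply.
Qed.

(** By compactness [W] contains all small multiples of [A]; balancedness keeps them in [A], where
    [W] and [V] coincide. *)
Lemma compact_vbounded_localized C (A : set X) : C A -> compact A ->
  absolutely_convex A -> A 0 -> vbounded (A : set (localized C)).
Proof.
move=> CA coA [_ bA] A0 U /nbhs_localizedP[V [_ V0 VU /(_ A CA)[W oW WV]]].
have W0 : nbhs 0 W.
  by apply: open_nbhs_nbhs; split=> //; have [] : (W `&` A) 0 by rewrite WV.
have [e e0 eW] : exists2 e : R, 0 < e & forall s, `|s| < e ->
    forall y, A y -> W (s *: y).
  have := (compact_near_coveringP A).1 coA _ (nbhs (0 : R^o))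
    (fun s y => W (s *: y)) _ (fun x _ => nbhs0_scale x W0).
  rewrite -nbhs_ballE => -[e /= e0 eW]; exists e => // s se y Ay.
  by apply: eW Ay; rewrite /ball /= sub0r normrN.
have ei0 : 0 < e^-1 by rewrite invr_gt0.
(* This threshold ensures both [|t^-1| < e] and [|t^-1| <= 1]. *)
exists (1 + e^-1) => [|t tr y Ay]; first lra.
have t1 : 1 <= `|t| by lra.
have t0 : t != 0 by rewrite -normr_gt0; lra.
have te : `|t^-1| < e.
  by rewrite normfV invf_plt ?posrE//; lra.
exists (t^-1 *: y); last by rewrite scalerA divff// scale1r.
apply: VU; have [] : (V `&` A) (t^-1 *: y); last by [].
rewrite -WV; split; first exact: eW.
by apply: bA => //; rewrite normfV invf_le1//; lra.
Qed.

Lemma vbounded_localized_sub (c : nat -> set X) (S : set X) :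
  hausdorff_space X -> (forall k, c k `<=` c k.+1) ->
  (forall k, absolutely_convex (c k)) -> (forall k, c k 0) ->
  (forall k, compact (c k)) -> vbounded (S : set (localized (range c))) ->
  exists k, exists2 r : R, 0 < r & S `<=` [set r *: x | x in c k].
Proof.
move=> hX cS ac c0 coc bS; apply: contrapT => nS.
have sep k : exists fy : (X -> R^o) * X, [/\ linear fy.1, continuous fy.1,
    forall x, c k x -> `|fy.1 x| <= k.+1%:R^-1, S fy.2 & k.+1%:R < fy.1 fy.2].
  have k0 : 0 < k.+1%:R :> R by rewrite ltr0n.
  (* With the square, dividing the separating form by [k.+1] leaves it small on [c k] and still
     above [k.+1] at [y]. *)
  pose r : R := k.+1%:R ^+ 2; have r0 : 0 < r by rewrite exprn_gt0.
  have [y [Sy ny]] : exists y, S y /\ ~ c k (r^-1 *: y).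
    apply: contrapT => nn; apply: nS; exists k, r => // y Sy.
    exists (r^-1 *: y); last by rewrite scalerA mulfV ?gt_eqF// scale1r.
    by apply: contrapT => nc; apply: nn; exists y.
  have clk : closed (c k) by exact: compact_closed.
  have [g [lg cg gc gy]] := closed_separation clk (ac k) (c0 k) ny.
  exists (fun x => k.+1%:R^-1 * g x, y); split => //=.
  - by move=> t u v; rewrite lg mulrDr !scalerAr -[t *: g u]/(t * g u) mulrCA.
  - by move=> x; apply: cvgM; [exact: cvg_cst|exact: cg].
  - move=> x /gc gx; rewrite normrM normfV (gtr0_norm k0).
    by apply: ler_piMr => //; rewrite invr_ge0 ltW.
  - move: gy; rewrite linear_formZ// -(ltr_pM2l r0) mulrA mulfV ?gt_eqF//.
    rewrite mulr1 mul1r /r expr2 => gy.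
    by rewrite -(ltr_pM2l k0) mulrA mulfV ?gt_eqF// mul1r.
have [fy fyP] := choice sep.
(* This prepolar absorbs [S], which bounds all the forms on [S] by one [r]; the form of an index
   [n > r] violates this. *)
have nB : nbhs (0 : localized (range c)) [set x | forall n, `|(fy n).1 x| <= 1].
  apply: nbhs_localized_polar => [n|n|A [k _ <-]].
  - by have [] := fyP n.
  - by have [lf cf _ _ _] := fyP n; exact: continuous_localized.
  - near=> n => y cy; have [_ _ /(_ y) fn _ _] := fyP n.
    have kn : (k <= n)%N by near: n; exact: nbhs_infty_ge.
    have n0 : (0 < n)%N by near: n; exact: nbhs_infty_gt.
    apply: (le_lt_trans (fn _)); last by rewrite invf_lt1 ?ltr0n// ltr1n.
    exact: (homo_leq (@subset_refl _) (@subset_trans _) cS) kn y cy.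
have [r r0 /(_ r (ler_norm r)) Sr] := bS _ nB.
have [n rn] : exists n : nat, r < n%:R.
  by exists (Num.bound r); exact: archi_boundP (ltW r0).
have [lf _ _ Sy ny] := fyP n; have [u /(_ n) un uy] := Sr _ Sy.
move: ny; rewrite -uy linear_formZ// => ny.
move: un; rewrite ler_norml => /andP[_ un].
have : r * (fy n).1 u <= r * 1 by rewrite ler_pM2l.
have : n%:R <= n.+1%:R :> R by rewrite ler_nat.
lra.
Unshelve. all: by end_near. Qed.

End localization.

(** * The Banach-Dieudonne construction *)

Section banach_dieudonne.
Context (R : realType) (X : tvsType R).
Implicit Types (D V : set X) (A F : seq (X -> R^o)).

(** Continuity refers to the original topology; [continuous_localized] transfers it to the localized
    one. *)
Definition polar_form D : set (X -> R^o) :=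
  [set f | [/\ linear f, continuous f & forall x, D x -> `|f x| <= 1]].

Definition finite_prepolar A : set X :=
  [set x | forall f, f \in A -> `|f x| <= 1].

(** Each point of [D'] outside [V] violates a form of [A] or, lying outside [D], a form of the polar
    of [D]; compactness leaves finitely many. *)
Lemma banach_dieudonne_step D D' V A :
  closed D -> absolutely_convex D -> D 0 -> compact D' ->
  (exists2 W, open W & W `&` D' = V `&` D') ->
  (forall f, f \in A -> continuous f) ->
  D `&` finite_prepolar A `<=` V ->
  exists F, [/\ (0 < size F)%N, forall f, f \in F -> polar_form D f
    & D' `&` finite_prepolar (A ++ F) `<=` V].
Proof.
move=> clD acD D0 coD' [W oW WV] cA DAV.
pose K := D' `&` ~` W.
have coK : compact K.
  by apply: compact_closedI => //; exact: open_closedC.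
(* [Z] is the filter of the sets of lists that contain all the extensions of some
   finite list of elements of the polar. *)
pose Z : set_system (seq (X -> R^o)) := [set Q | exists2 s : seq (X -> R^o),
  forall f, f \in s -> polar_form D f
    & forall s' : seq (X -> R^o), {subset s <= s'} -> Q s'].
have ZF : Filter Z.
  split=> [|P Q [s sD sP] [t tD tQ]|P Q PQ [s sD sP]].
  - by exists [::].
  - exists (s ++ t) => [f|s' ss']; first by rewrite mem_cat => /orP[/sD|/tD].
    split; first by apply: sP => f fs; apply: ss'; rewrite mem_cat fs.
    by apply: tQ => f ft; apply: ss'; rewrite mem_cat ft orbT.
  - by exists s => // s' /sP/PQ.
have openU (f : X -> R^o) : continuous f -> open [set x | 1 < `|f x|].
  move=> cf; have cn : continuous (fun x => `|f x| : R^o).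
    by move=> x; apply: cvg_norm; exact: cf.
  by have /continuousP/(_ _ (@open_gt R 1)) := cn.
have [x [D'x nWx]|F FD FK] := (compact_near_coveringP K).1 coK _ Z
    (fun s x => exists2 f, f \in A ++ s & 1 < `|f x|) ZF.
- have nVx : ~ V x.
    by move=> Vx; apply: nWx; have [] : (W `&` D') x by rewrite WV.
  have [[f fA fx]|nA] := pselect (exists2 f, f \in A & 1 < `|f x|).
    exists ([set y | 1 < `|f y|], setT) => /=.
      split; last exact: filterT.
      by apply: open_nbhs_nbhs; split => //; exact/openU/cA.
    by move=> [y s] [/= fy _]; exists f => //; rewrite mem_cat fA.
  have nDx : ~ D x.
    move=> Dx; apply: nVx; apply: DAV; split=> // f fA.
    by rewrite leNgt; apply/negP => fx; apply: nA; exists f.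
  have [f [lf cf fD fx]] := closed_separation clD acD D0 nDx.
  exists ([set y | 1 < `|f y|], [set s : seq (X -> R^o) | f \in s]) => /=.
    split; first apply: open_nbhs_nbhs.
      by split; [exact: openU|rewrite /= (lt_le_trans fx)// ler_norm].
    exists [:: f] => [g|s]; first by rewrite inE => /eqP ->.
    by apply; rewrite inE.
  by move=> [y s] [/= fy fs]; exists f => //; rewrite mem_cat fs orbT.
(* The zero form makes the extension nonempty, so that the lists in [banach_dieudonne] grow at each
   stage. *)
pose zero : X -> R^o := fun=> 0.
exists (zero :: F); split => // [f|x [D'x Ax]].
  rewrite inE => /predU1P[->|/FD//].
  split=> [t x y|x|x _]; last by rewrite /zero normr0.
    by rewrite /zero scaler0 addr0.
  exact: cvg_cst.
apply: contrapT => nVx.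
have [|f /= AFf] := FK F (fun _ => id) x.
  by split=> // Wx; apply: nVx; have [] : (V `&` D') x by rewrite -WV.
rewrite ltNge => /negP; apply; apply: Ax.
by move: AFf; rewrite !mem_cat inE => /orP[->//|->]; rewrite !orbT.
Qed.

(** Iterating the step gives nested lists [A k], whose union is enumerated by a single sequence. *)
Lemma banach_dieudonne (D : nat -> set X) V :
  (forall k, closed (D k)) -> (forall k, absolutely_convex (D k)) ->
  (forall k, D k 0) -> (forall k, compact (D k)) ->
  (forall k, D k `<=` D k.+1) -> D 0%N `<=` V ->
  (forall k, exists2 W, open W & W `&` D k = V `&` D k) ->
  exists x : nat -> X -> R^o,
    [/\ forall n, linear (x n), forall n, continuous (x n),
      forall k, \forall n \near \oo, polar_form (D k) (x n)
    & (\bigcup_k D k) `&` [set y | forall n, `|x n y| <= 1] `<=` V].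
Proof.
move=> clD acD D00 coD DS D0V VD.
pose P k A := (forall f, f \in A -> linear f /\ continuous f) /\
  D k `&` finite_prepolar A `<=` V.
have /choice[g gP] (kA : nat * seq (X -> R^o)) : exists F, P kA.1 kA.2 ->
    [/\ (0 < size F)%N, forall f, f \in F -> polar_form (D kA.1) f
      & P kA.1.+1 (kA.2 ++ F)].
  case: kA => k A /=; have [[lcA DA]|nP] := pselect (P k A); last by exists [::].
  have cA f : f \in A -> continuous f by move=> /lcA[].
  have [F [F0 FD FV]] := banach_dieudonne_step (clD k) (acD k) (D00 k)
    (coD k.+1) (VD k.+1) cA DA.
  exists F => _; split=> //; split=> // f; rewrite mem_cat => /orP[/lcA//|/FD[]].
  by [].
pose A := fix A k := if k is k'.+1 then A k' ++ g (k', A k') else [::].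
have PA k : P k (A k).
  elim: k => [|k /(gP (k, _))[]//]; split=> //.
  by move=> x [/D0V].
have gA k : (0 < size (g (k, A k)))%N /\
    forall f, f \in g (k, A k) -> polar_form (D k) f.
  by have [] := gP (k, A k) (PA k).
pose zero : X -> R^o := fun=> 0.
have sA k : (k <= size (A k))%N.
  elim: k => // k kA; rewrite /= size_cat -addn1 leq_add//.
  by have [] := gA k.
have nthA n j k : (n < size (A j))%N -> (j <= k)%N ->
    nth zero (A k) n = nth zero (A j) n.
  move=> nj /subnK <-; elim: (k - j)%N => // m IH.
  rewrite addSn /= nth_cat; case: ltnP => // mn.
  have : (size (A j) <= size (A (m + j)))%N.
    by elim: {IH mn} m => // m; rewrite addSn /= size_cat => /leq_trans -> //;
      exact: leq_addr.
  by move=> /(leq_trans nj); rewrite ltnNge mn.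
(* An entry beyond [A k] was added at stage [k] or later, hence lies in the polar of a set
   containing [D k]. *)
have DA k m n : (size (A k) <= n < size (A (m + k)))%N ->
    polar_form (D k) (nth zero (A (m + k)%N) n).
  elim: m => [|m IH]; first by move=> /andP[kn]; rewrite ltnNge kn.
  rewrite addSn /= size_cat nth_cat => /andP[kn nk].
  case: ltnP => nm; first by apply: IH; rewrite kn.
  have [|lf cf fD] := (gA (m + k)%N).2
    (nth zero (g ((m + k)%N, A (m + k)%N)) (n - size (A (m + k)%N))%N).
    by apply: mem_nth; rewrite ltn_subLR.
  split=> // x Dx; apply: fD.
  exact: (homo_leq (@subset_refl _) (@subset_trans _) DS) (leq_addl _ _) x Dx.
pose x n := nth zero (A n.+1) n.
have xA n : x n \in A n.+1 by apply: mem_nth; exact: sA.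
exists x; split.
- by move=> n; have [] := (PA n.+1).1 _ (xA n).
- by move=> n; have [] := (PA n.+1).1 _ (xA n).
- move=> k; near=> n.
  have kn : (size (A k) <= n)%N by near: n; exact: nbhs_infty_ge.
  have kn1 : (k <= n.+1)%N by rewrite (leq_trans (sA k))// (leq_trans kn).
  have := @DA k (n.+1 - k)%N n; rewrite subnK// kn sA.
  exact.
- move=> y [[k _ Dky] xy]; apply: (PA k).2; split=> // f fA.
  have ik : (index f (A k) < size (A k))%N by rewrite index_mem.
  rewrite -(nth_index zero fA).
  (* Whichever of [A k] and the list defining this term of [x] is longer, the two agree at this
     index. *)
  have [|/ltnW] := leqP k (index f (A k)).+1 => [ki|ik1].
    by rewrite -(nthA _ _ _ ik ki); exact: xy.
  by rewrite (nthA _ _ _ (sA _) ik1); exact: xy.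
Unshelve. all: by end_near. Qed.

End banach_dieudonne.

(** * Dilations, strong null sequences and the local base *)

Lemma tvs_scaler_continuous (R : realType) (X : tvsType R) (r : R) :
  continuous ( *:%R r : X -> X).
Proof.
move=> x.
exact: (cvg_comp2 (cvg_cst _) cvg_id (@scale_continuous R X (_, _))).
Qed.

Lemma absolutely_convexZ (R : realType) (X : lmodType R) (r : R) (A : set X) :
  absolutely_convex A -> absolutely_convex [set r *: x | x in A].
Proof.
move=> [cA bA]; split.
  apply/convex_setP => _ _ t t0 t1 [x Ax <-] [y Ay <-].
  exists (t *: x + (1 - t) *: y); first exact: (convex_setP A).1.
  by rewrite scalerDr !scalerA [r * t]mulrC [r * (1 - t)]mulrC.
by move=> t _ t1 [x Ax <-]; exists (t *: x); [exact: bA|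
  rewrite !scalerA mulrC].
Qed.

Lemma absolutely_convex_sub_scale (R : realType) (X : lmodType R) (r : R)
    (A : set X) : absolutely_convex A -> 1 <= r -> A `<=` [set r *: x | x in A].
Proof.
move=> [_ bA] r1 x Ax; have r0 : 0 < r by lra.
exists (r^-1 *: x); last by rewrite scalerA mulfV ?gt_eqF// scale1r.
by apply: bA => //; rewrite normfV gtr0_norm// invf_le1.
Qed.

Lemma cvg_zero_form_range (R : realType) (X : tvsType R) (c : nat -> set X)
    (x : nat -> dual (localized (range c))) :
  hausdorff_space X -> (forall k, c k `<=` c k.+1) ->
  (forall k, absolutely_convex (c k)) -> (forall k, c k 0) ->
  (forall k, compact (c k)) ->
  x @ \oo --> zero_form (localized (range c)) <->
  forall k (e : R), 0 < e -> \forall n \near \oo,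
    forall y, c k y -> `|(set_val (x n) : X -> R^o) y| < e.
Proof.
move=> hX cS ac c0 coc; rewrite cvg_zero_formP; split=> [x0 k|x0 S].
  by apply: x0; apply: compact_vbounded_localized.
move=> /(vbounded_localized_sub hX cS ac c0 coc)[k [r r0 Sr]] e e0.
(* A form below [e / r] on [c k] is below [e] on its dilate by [r], which contains [S]. *)
have er0 : 0 < e / r by rewrite divr_gt0.
apply: filterS (x0 k _ er0) => n xn _ /Sr[y cy <-].
have /set_mem[lx _] := valP (x n).
rewrite [X in `|X|](_ : _ = r * (set_val (x n) : X -> R^o) y); last first.
  exact: linear_formZ.
rewrite normrM gtr0_norm// mulrC -ltr_pdivlMr//; exact: xn.
Qed.

Theorem theorem7p5 (R : realType) (X : tvsType R) (hX : hausdorff_space X)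
    (C : set (set X)) (locC : localizing_family C)
    (countC : nondecreasing_countable C)
    (acC : forall A, C A -> absolutely_convex A)
    (compactC : forall A, C A -> compact A) :
  @local_base R (localized C)
    [set \bigcap_n prepolar (x n) | x in
       [set x : nat -> dual (localized C) |
          x @ \oo --> zero_form (localized C)]].
Proof.
have [c Cc cS] := countC; rewrite Cc in locC acC compactC *.
have Cck k : range c (c k) by exists k.
have ac k : absolutely_convex (c k) by exact: acC.
have coc k : compact (c k) by exact: compactC.
have [_ C0 Cscale] := locC.
have c0 k : c k 0 by have [] := C0 _ (Cck k).
have xP := cvg_zero_form_range _ hX cS ac c0 coc.
split=> [_ [x /xP x0 <-]|U /nbhs_localizedP[V [cV V0 VU CV]]].
  have dx n : linear (set_val (x n) : X -> R^o) /\
    continuous (set_val (x n) : localized (range c) -> R^o).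
    by have /set_mem := valP (x n).
  have nb := nbhs_localized_polar (fun n => (dx n).1) (fun n => (dx n).2).
  apply: filterS (nb _) => [y xy n _|A [k _ <-]].
    exact: xy.
  exact: x0.
(* [D 0] is the singleton [0] so that the construction starts from the empty
   list; the dilations ensure that the functionals decrease on each [c k]. *)
pose D k := if k is k'.+1 then [set k'.+1%:R *: x | x in c k'] else [set 0].
have acD k : absolutely_convex (D k).
  case: k => [|k]; last exact: absolutely_convexZ.
  split=> [|t _ _ /= ->]; last by rewrite scaler0.
  by apply/convex_setP => x y t _ _ -> ->; rewrite !scaler0 addr0.
have D0 k : D k 0.
  by case: k => // k; exists 0; rewrite ?scaler0.
have coD k : compact (D k).
  case: k => [|k]; first exact: compact_set1.
  apply: continuous_compact; last exact: coc.
  by apply: continuous_subspaceT; exact: tvs_scaler_continuous.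
have DS k : D k `<=` D k.+1.
  case: k => [|k] y; first by move=> ->; exact: (D0 1%N).
  move=> [x cx <-].
  have k2 : k.+2%:R != 0 :> R by rewrite pnatr_eq0.
  exists ((k.+1%:R / k.+2%:R) *: x).
    apply: (ac _).2; last exact: cS.
    by rewrite ger0_norm ?divr_ge0// ler_pdivrMr ?ltr0n// mul1r ler_nat.
  by rewrite scalerA mulrCA mulfV// mulr1.
have VD k : exists2 W, open W & W `&` D k = V `&` D k.
  (* The scaling axiom puts [D k] inside a member [A], from which it inherits the open trace of
     [V]. *)
  have [A CA DA] : exists2 A, range c A & D k `<=` A.
    case: k => [|k]; first by exists (c 0%N) => // x ->; exact: c0.
    have [A CA kA] := Cscale (c k) 0 k.+1%:R (Cck k).
    by exists A => // _ [x cx <-]; apply: kA; exists x; rewrite ?add0r.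
  have [W oW WA] := CV A CA; exists W => //.
  rewrite predeqE => x; split=> -[Wx Dx]; split=> //.
    by have [] : (V `&` A) x by rewrite -WA; split=> //; exact: DA.
  by have [] : (W `&` A) x by rewrite WA; split=> //; exact: DA.
have clD k : closed (D k) by exact: compact_closed.
have [|x [lx cx xD DxV]] := banach_dieudonne clD acD D0 coD DS _ VD.
  by move=> _ ->.
have dx n : (x n : localized (range c) -> R^o) \in dual (localized (range c)).
  apply/mem_set; split; first exact: lx.
  exact: continuous_localized.
pose xd n : dual (localized (range c)) := SigSub (dx n).
exists (\bigcap_n prepolar (xd n)).
  exists xd => //; apply/xP => k e e0 /=.
  (* [m >= k] puts [c k] inside [c m]; a form in the polar of [D m.+1] is at most the inverse of
     [m.+1] on [c m], which is below [e]. *)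
  pose m := maxn k (Num.bound e^-1).
  have ei0 : 0 <= e^-1 by rewrite invr_ge0 ltW.
  have em : e^-1 < m.+1%:R.
    apply: lt_le_trans (archi_boundP ei0) _.
    by rewrite ler_nat leqW// leq_maxr.
  apply: filterS (xD m.+1) => n [_ _ xn] y cky.
  have cmy : c m y.
    move: y cky.
    exact: (homo_leq (@subset_refl _) (@subset_trans _) cS) (leq_maxl _ _).
  have := xn (m.+1%:R *: y); rewrite linear_formZ// normrM normr_nat.
  have m0 : 0 < m.+1%:R :> R by rewrite ltr0n.
  rewrite mulrC -ler_pdivlMr// mul1r => xy; apply: le_lt_trans (xy _) _.
    by exists y.
  by rewrite invf_plt.
move=> y xy; apply: VU; apply: DxV; split; last first.
  by move=> n; exact: (xy n).
(* The scaling axiom with factor [0] puts [y] in some [c k], hence in [D k.+1]: the sets [D k] cover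
   [X]. *)
have [_ [k _ <-] kA] := Cscale (c 0%N) y 0 (Cck 0%N).
exists k.+1 => //; apply: absolutely_convex_sub_scale; rewrite ?ler1n//.
by apply: kA; exists 0; rewrite ?scale0r ?addr0.
Qed.
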